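(* Assume $C\succ 0$, the matrices $A_1,\dots,A_m$ are linearly independent, and $C^{-1}$ is linearly feasible, i.e. $\mathrm{tr}(A_\ell C^{-1})=b_\ell$ for all $\ell\in[m]$. Let $X(t)$ be a differentiable solution of the first-ansatz dynamics $$\mathrm{vec}(\dot X) = -\bigl(I - G\mathcal{A}^T(\mathcal{A}G\mathcal{A}^T)^{-1} \mathcal{A}\bigr)G\,\mathrm{vec}(C),\qquad G=\tfrac12\bigl(C^{-1}\otimes X + X\otimes C^{-1}\bigr),$$ with $X(0)\succ 0$ linearly feasible. Then at every time $t$ with $X(t)\succ 0$, $$\frac{d}{dt}\ln\det X(t) = -n + b^T(\mathcal{A}G\mathcal{A}^T)^{-1}b \ \ge\ -n .$$ Consequently $X(T)\succ 0$ for every finite $T\ge 0$.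
   Context: We consider the SDP $\min\{\mathrm{tr}(CX): \mathrm{tr}(A_\ell X)=b_\ell\ \forall \ell\in[m],\ X\succeq 0\}$ with symmetric $n\times n$ matrices $C,A_1,\dots,A_m$ and $b\in\mathbb{R}^m$. For an $n\times n$ matrix $M$, $\mathrm{vec}(M)\in\mathbb{R}^{n^2}$ is obtained by stacking the columns of $M$; $\otimes$ is the Kronecker product, with $\mathrm{vec}(ABC)=(C^T\otimes A)\mathrm{vec}(B)$. $\mathcal{A}$ is the $m\times n^2$ matrix whose $\ell$-th row is $\mathrm{vec}(A_\ell)^T$. A matrix $X$ is linearly feasible if $\mathcal{A}\,\mathrm{vec}(X)=b$. *)

(* Defs.v *)
From HB Require Import structures.
From mathcomp Require Import all_boot all_order all_algebra.
From mathcomp Require Import all_classical all_reals all_analysis.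
From mathcomp Require Import mxtens.
Set Implicit Arguments. Unset Strict Implicit. Unset Printing Implicit Defensive.
Import Order.TTheory GRing.Theory Num.Theory.
Local Open Scope ring_scope.

(* Kronecker product: the library's [tensmx] (real_closed/mxtens.v), with
   (A *t B) (i1*p+i2) (j1*q+j2) = A i1 j1 * B i2 j2 (standard convention). *)

(* vec M: stack the columns of M; entry k = j*n + i is M i j. *)
Definition vec {R : pzRingType} {n : nat} (M : 'M[R]_n) : 'cV[R]_(n * n) :=
  \col_k M (mxtens_unindex k).2 (mxtens_unindex k).1.

Definition calA {R : pzRingType} {m n : nat} (A : 'I_m -> 'M[R]_n)
  : 'M[R]_(m, n * n) := \matrix_(l, k) vec (A l) k 0.

Definition linfeas {R : pzRingType} {m n : nat} (A : 'I_m -> 'M[R]_n)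
  (b : 'cV[R]_m) (X : 'M[R]_n) : Prop := calA A *m vec X = b.

Definition posdef {R : numDomainType} {n : nat} (M : 'M[R]_n) : Prop :=
  M^T = M /\ forall x : 'cV[R]_n, x != 0 -> 0 < (x^T *m M *m x) 0 0.

Definition Gmat {R : fieldType} {n : nat} (C X : 'M[R]_n) : 'M[R]_(n * n) :=
  (2%:R)^-1 *: (tensmx (invmx C) X + tensmx X (invmx C)).

(* Main.v *)
(** Whatever [X] is, the velocity is
    [X' = (X B C^-1 + C^-1 B X^T) / 2 - (X + X^T) / 2], where
    [B = \sum_l w_l A_l] is symmetric. Hence [X'] is symmetric and [X t] is
    symmetric for all [t >= 0], even where the normal matrix [A G A^T] might be
    singular (there [invmx] is a junk value). As long as [X] is positive
    definite, so is [G], hence [A G A^T] is invertible, [A vec X] is constant,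
    [w = (A G A^T)^-1 b], and Jacobi's formula gives
    [(ln det X)' = tr (X' X^-1) = - n + tr (B C^-1) = - n + b^T (A G A^T)^-1 b].

    If [X] were not always positive definite, let [S] be the infimum of the bad
    times. On [[0, S[] the function [det X * exp (n t)] is nondecreasing, so
    [det X S > 0]; as a limit of positive definite matrices [X S] is positive
    semidefinite, hence positive definite. Positive definiteness is open among
    symmetric matrices, which contradicts the choice of [S]. *)

Require Import Defs.
From HB Require Import structures.
From mathcomp Require Import all_boot all_order all_algebra.
From mathcomp Require Import all_classical all_reals all_analysis.
From mathcomp Require Import mxtens.
From mathcomp Require Import perm ring lra.
Import Order.TTheory GRing.Theory Num.Theory.
Local Open Scope ring_scope.

(** * Vectorization and the Kronecker product *)

Lemma vec_tens_index {R : pzRingType} {n : nat} (M : 'M[R]_n) i j :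
  vec M (mxtens_index (j, i)) 0 = M i j.
Proof. by rewrite mxE mxtens_indexK. Qed.

Lemma vec_inj {R : pzRingType} {n : nat} : injective (@vec R n).
Proof.
move=> M N /matrixP MN; apply/matrixP => i j.
by have := MN (mxtens_index (j, i)) 0; rewrite !vec_tens_index.
Qed.

Lemma vecD {R : pzRingType} {n : nat} (M N : 'M[R]_n) :
  vec (M + N) = vec M + vec N.
Proof. by apply/matrixP => k l; rewrite !mxE. Qed.

Lemma vecN {R : pzRingType} {n : nat} (M : 'M[R]_n) : vec (- M) = - vec M.
Proof. by apply/matrixP => k l; rewrite !mxE. Qed.

Lemma vecZ {R : pzRingType} {n : nat} (a : R) (M : 'M[R]_n) :
  vec (a *: M) = a *: vec M.
Proof. by apply/matrixP => k l; rewrite !mxE. Qed.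

Lemma big_mxtens (R : nmodType) (m n : nat) (F : 'I_(m * n) -> R) :
  \sum_k F k = \sum_i \sum_j F (mxtens_index (i, j)).
Proof.
rewrite pair_bigA /=.
rewrite (reindex (@mxtens_index m n)) /=; last first.
  by exists (@mxtens_unindex m n) => ? _;
    rewrite ?mxtens_indexK ?mxtens_unindexK.
by apply: eq_bigr => -[].
Qed.

Lemma tensmx_vec {R : comPzRingType} {n : nat} (P Q M : 'M[R]_n) :
  tensmx P Q *m vec M = vec (Q *m M *m P^T).
Proof.
apply/matrixP => k l; rewrite ord1 {l}.
case: (mxtens_indexP k) => j i; rewrite vec_tens_index !mxE big_mxtens.
apply: eq_bigr => j' _; rewrite !mxE big_distrl /=.
by apply: eq_bigr => i' _; rewrite tensmxE vec_tens_index -mulrA mulrC.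
Qed.

Lemma dot_vec {R : comPzRingType} {n : nat} (M N : 'M[R]_n) :
  ((vec M)^T *m vec N) 0 0 = \tr (M^T *m N).
Proof.
rewrite mxE big_mxtens; apply: eq_bigr => j _; rewrite mxE.
by apply: eq_bigr => i _; rewrite !mxE !mxtens_indexK.
Qed.

Lemma calA_vecE {R : comPzRingType} {m n : nat} (A : 'I_m -> 'M[R]_n)
    (M : 'M[R]_n) (l : 'I_m) :
  (calA A *m vec M) l 0 = \tr ((A l)^T *m M).
Proof. by rewrite -dot_vec !mxE; apply: eq_bigr => k _; rewrite !mxE. Qed.

Lemma trmx_calA_mul {R : comPzRingType} {m n : nat} (A : 'I_m -> 'M[R]_n)
    (w : 'cV[R]_m) :
  (calA A)^T *m w = vec (\sum_l w l 0 *: A l).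
Proof.
apply/matrixP => k z; rewrite ord1 {z}.
case: (mxtens_indexP k) => j i; rewrite vec_tens_index !mxE summxE.
by apply: eq_bigr => l _; rewrite !mxE mxtens_indexK mulrC.
Qed.

(** The transpose on [X] is kept because the symmetry of [X t] is itself derived from this
    formula. *)
Lemma Gmat_vec {R : fieldType} {n : nat} (C X M : 'M[R]_n) : C^T = C ->
  Gmat C X *m vec M = vec (2^-1 *: (X *m M *m invmx C + invmx C *m M *m X^T)).
Proof.
move=> Csym.
by rewrite -scalemxAl mulmxDl !tensmx_vec vecZ vecD trmx_inv Csym.
Qed.

Lemma trmx_sum_sym {R : comPzRingType} {m n : nat} (A : 'I_m -> 'M[R]_n)
    (w : 'cV[R]_m) : (forall l, (A l)^T = A l) ->
  (\sum_l w l 0 *: A l)^T = \sum_l w l 0 *: A l.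
Proof.
move=> As; rewrite raddf_sum /=.
by apply: eq_bigr => l _; rewrite linearZ /= As.
Qed.

(** * Positive definite matrices *)

Lemma unitmx_ker0 {R : fieldType} {n : nat} (M : 'M[R]_n) :
  (forall x : 'cV[R]_n, M *m x = 0 -> x = 0) -> M \in unitmx.
Proof.
(* [kermx] is a left kernel: its rows for [M^T] are the transposes of the vectors that [M] kills. *)
move=> inj; rewrite -unitmx_tr -row_free_unit -kermx_eq0.
apply/eqP/row_matrixP => i; rewrite row0; apply: trmx_inj; rewrite trmx0.
apply: inj; apply: trmx_inj; rewrite trmx_mul trmxK trmx0.
by rewrite -row_mul mulmx_ker row0.
Qed.

Lemma posdef_unitmx {R : numFieldType} {n : nat} (M : 'M[R]_n) :
  posdef M -> M \in unitmx.
Proof.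
move=> [_ Mpos]; apply: unitmx_ker0 => x Mx0; apply/eqP/negPn/negP => /Mpos.
by rewrite -mulmxA Mx0 mulmx0 mxE ltxx.
Qed.

Lemma posdef_invmx {R : numFieldType} {n : nat} (M : 'M[R]_n) :
  posdef M -> posdef (invmx M).
Proof.
move=> Mpd; have Mu := posdef_unitmx M Mpd; case: (Mpd) => Msym Mpos.
split=> [|x x0]; first by rewrite trmx_inv Msym.
have y0 : invmx M *m x != 0.
  by apply: contraNneq x0 => y0; rewrite -(mulKVmx Mu x) y0 mulmx0.
by have := Mpos _ y0; rewrite trmx_mul trmx_inv Msym mulmxKV// mulmxA.
Qed.

Lemma quad_trace {R : comPzRingType} {n : nat} (M : 'M[R]_n) (x : 'cV[R]_n) :
  (x^T *m M *m x) 0 0 = \tr (x *m x^T *m M).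
Proof. by rewrite -trace_mx11 mxtrace_mulC mulmxA. Qed.

Lemma posdef_ge0 {R : numDomainType} {n : nat} (M : 'M[R]_n) (x : 'cV[R]_n) :
  posdef M -> 0 <= (x^T *m M *m x) 0 0.
Proof.
move=> [_ Mpos]; have [->|/Mpos/ltW//] := eqVneq x 0.
by rewrite mulmx0 mxE.
Qed.

(** At [u = invmx N *m b] the form equals [u^T *m b], a scalar, hence equal to its transpose
    [b^T *m invmx N *m b]. *)
Lemma quad_invmx_ge0 {R : realFieldType} {m : nat} (N : 'M[R]_m)
    (b : 'cV[R]_m) :
  N \in unitmx -> (forall u : 'cV[R]_m, 0 <= (u^T *m N *m u) 0 0) ->
  0 <= (b^T *m invmx N *m b) 0 0.
Proof.
move=> Nu /(_ (invmx N *m b)).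
by rewrite -mulmxA mulKVmx// -trace_mx11 mxtrace_mulC -mxtrace_tr trmx_mul trmxK
  mxtrace_mulC mulmxA trace_mx11.
Qed.

Lemma dotmx_ge0 {R : realDomainType} {n : nat} (x : 'cV[R]_n) :
  0 <= (x^T *m x) 0 0.
Proof.
by rewrite mxE; apply: sumr_ge0 => i _; rewrite mxE -expr2 sqr_ge0.
Qed.

Lemma dotmx_eq0 {R : realDomainType} {n : nat} (x : 'cV[R]_n) :
  (x^T *m x) 0 0 = 0 -> x = 0.
Proof.
rewrite mxE => /eqP; rewrite psumr_eq0; last first.
  by move=> i _; rewrite mxE -expr2 sqr_ge0.
move=> /allP x0; apply/matrixP => i j; rewrite ord1 mxE.
have := x0 i; rewrite mem_index_enum => /(_ isT).
by rewrite mxE -expr2 sqrf_eq0 => /eqP.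
Qed.

(** If the form vanishes at some [x != 0], then [y = M x] is nonzero, and moving from [x] along
    [- y] has first-order rate [-2 |y|^2], so the form would become negative. *)
Lemma psd_unit_posdef {R : realFieldType} {n : nat} (M : 'M[R]_n) :
  M^T = M -> (forall x : 'cV[R]_n, 0 <= (x^T *m M *m x) 0 0) ->
  M \in unitmx -> posdef M.
Proof.
move=> Msym Mge0 Mu; split=> // x x0; rewrite lt_neqAle Mge0 andbT.
apply/eqP => /esym q0.
pose y := M *m x; pose p : R := (y^T *m y) 0 0.
pose q : R := (y^T *m M *m y) 0 0.
have p0 : 0 < p.
  rewrite lt_neqAle dotmx_ge0 andbT; apply/eqP => /esym/dotmx_eq0 y0.
  by move/eqP: x0; apply; rewrite -(mulKmx Mu x) -/y y0 mulmx0.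
have q_ge0 : 0 <= q by exact: Mge0.
have expand t : ((x + t *: y)^T *m M *m (x + t *: y)) 0 0 = t * (2 * p + t * q).
  rewrite [(x + _)^T]linearD /= [(t *: y)^T]linearZ /= !mulmxDl !mulmxDr.
  rewrite -!scalemxAl -!scalemxAr.
  have e1 : x^T *m M *m y = y^T *m y by rewrite /y trmx_mul Msym.
  have e2 : y^T *m M *m x = y^T *m y by rewrite -mulmxA.
  rewrite e1 e2.
  transitivity (0 + t * p + (t * p + t * (t * q))); last by ring.
  by rewrite /p /q -q0 !mxE.
(* Small enough that [2 * p + t * q] stays positive; the [+ 1] covers [q = 0]. *)
pose t := - (p / (q + 1)).
have := Mge0 (x + t *: y); rewrite expand leNgt => /negP; apply.
have q1 : 0 < q + 1 by lra.
have tq : t * q + p = p / (q + 1) by rewrite /t; field; rewrite gt_eqF.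
have d0 : 0 < p / (q + 1) by rewrite divr_gt0.
by rewrite nmulr_rlt0 /t ?oppr_lt0//; rewrite -/t; lra.
Qed.

(** Induction on the size: the first column of the factor is [al] above [l], and the remaining block
    factors the Schur complement [S]. Only the factorization is recorded, not the triangular
    shape. *)
Lemma cholesky {R : rcfType} {n : nat} (M : 'M[R]_n) :
  posdef M -> exists L : 'M[R]_n, M = L *m L^T.
Proof.
elim: n M => [|n IHn] M; first by exists 0; rewrite !flatmx0.
rewrite -[n.+1]/(1 + n)%N in M * => -[].
rewrite -{1 2 3}[M]submxK tr_block_mx => /eq_block_mx[].
set a := ulsubmx M; set c := ursubmx M; set b := dlsubmx M; set D := drsubmx M.
move=> _ bc _ Dsym Mpos.
have a0 : 0 < a 0 0.
  have /Mpos : col_mx (1%:M : 'M[R]_1) (0 : 'cV[R]_n) != 0.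
    apply/eqP => /matrixP /(_ (lshift n 0) 0).
    by rewrite col_mxEu !mxE eqxx => /eqP; rewrite oner_eq0.
  rewrite tr_col_mx trmx0 trmx1 mul_row_block mul_row_col.
  by rewrite !mul0mx !mulmx0 mul1mx mulmx1 !addr0.
pose al := Num.sqrt (a 0 0).
have al0 : 0 < al by rewrite sqrtr_gt0.
have al2 : al * al = a 0 0 by rewrite -expr2 sqr_sqrtr// ltW.
have alM : al%:M *m al%:M = a.
  by rewrite -scalar_mxM al2; apply/matrixP => i j; rewrite !ord1 mxE eqxx.
pose l := al^-1 *: b.
have bE : l *m al%:M = b.
  by rewrite mul_mx_scalar /l scalerA divff ?scale1r// gt_eqF.
have cE : al%:M *m l^T = c.
  by rewrite -bc -bE trmx_mul tr_scalar_mx.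
pose S := D - l *m l^T.
have [|K SK] := IHn S.
  split=> [|y y0]; first by rewrite linearB /= trmx_mul trmxK Dsym.
  (* This [u] minimizes the form of [M] over the first coordinate with [y] fixed; the minimum is
     [y^T S y]. *)
  pose u : 'M[R]_1 := - (al^-1 *: (l^T *m y)).
  have lu : al%:M *m u = - (l^T *m y).
    by rewrite mul_scalar_mx scalerN scalerA divff ?scale1r// gt_eqF.
  have /Mpos : col_mx u y != 0 by rewrite col_mx_eq0 negb_and y0 orbT.
  rewrite tr_col_mx mul_row_block mul_row_col.
  have -> : u^T *m a + y^T *m b = 0.
    rewrite -alM -bE mulmxA [y^T *m _]mulmxA -mulmxDl.
    have -> : u^T *m al%:M = - (y^T *m l).
      by rewrite -[al%:M]tr_scalar_mx -trmx_mul lu linearN /= trmx_mul trmxK.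
    by rewrite addNr mul0mx.
  rewrite mul0mx add0r.
  have -> : u^T *m c = - (y^T *m l *m l^T).
    rewrite -cE mulmxA -[al%:M]tr_scalar_mx -trmx_mul lu linearN /= mulNmx.
    by rewrite trmx_mul trmxK.
  by rewrite /S mulmxBr addrC mulmxA.
exists (block_mx al%:M 0 l K).
rewrite tr_block_mx mulmx_block trmx0 tr_scalar_mx !mulmx0 !mul0mx !addr0.
rewrite alM cE bE -SK /S addrC subrK.
by rewrite -[LHS]submxK.
Qed.

Lemma posdef_det_gt0 {R : rcfType} {n : nat} (M : 'M[R]_n) :
  posdef M -> 0 < \det M.
Proof.
move=> Mpd; have := posdef_unitmx M Mpd; rewrite unitmxE unitfE.
have [L ->] := cholesky M Mpd.
by rewrite det_mulmx det_tr -expr2 exprn_even_gt0//= sqrf_eq0.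
Qed.

(** With [Q = L L^T] the trace is the sum of [x^T X x] over the columns [x] of [M L]. These are not
    all zero, since [M L = 0] would give [M Q = 0]. *)
Lemma posdef_trace_gt0 {R : rcfType} {n : nat} (X Q M : 'M[R]_n) :
  posdef X -> posdef Q -> M != 0 -> 0 < \tr (M^T *m X *m M *m Q).
Proof.
move=> Xpd Qpd M0; have Qu := posdef_unitmx Q Qpd.
have [L QL] := cholesky Q Qpd.
pose N := M *m L.
have N0 : N != 0.
  apply: contraNneq M0 => N0.
  by rewrite -(mulmxK Qu M) QL mulmxA -/N N0 !mul0mx.
have -> : \tr (M^T *m X *m M *m Q) =
    \sum_i ((col i N)^T *m X *m col i N) 0 0.
  rewrite QL mulmxA mxtrace_mulC !mulmxA -trmx_mul -/N -mulmxA -/N.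
  apply: eq_bigr => i _; rewrite [LHS]mxE [RHS]mxE.
  apply: eq_bigr => j _; congr (_ * _); last by rewrite !mxE.
  by rewrite !mxE; apply: eq_bigr => k _; rewrite !mxE.
have [j0 Nj0] : exists j, col j N != 0.
  apply/existsP; apply: contraNT N0; rewrite negb_exists => /forallP N0.
  apply/eqP/matrixP => k j; have := N0 j; rewrite negbK => /eqP/matrixP/(_ k 0).
  by rewrite !mxE.
rewrite (bigD1 j0) //=; apply: ltr_pwDl; first by case: Xpd => _; apply.
by apply: sumr_ge0 => j _; exact: posdef_ge0.
Qed.

(* Bounding [x = invmx L^T *m (L^T *m x)] coordinatewise gives
   [(\sum_i `|x i|)^2 <= k^2 * x^T M x], which absorbs the perturbation. *)
Lemma posdef_near {R : rcfType} {n : nat} (M : 'M[R]_n) : posdef M ->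
  exists2 e : R, 0 < e & forall N : 'M[R]_n, N^T = N ->
    (forall i j, `|N i j - M i j| <= e) -> posdef N.
Proof.
move=> Mpd; have Mu := posdef_unitmx M Mpd.
have [L ML] := cholesky M Mpd.
(* Since [M = L L^T], this [K] is the inverse of [L^T]. *)
pose K := invmx M *m L; pose k := \sum_i \sum_j `|K i j|.
have k0 : 0 <= k by do 2!apply: sumr_ge0 => ? _.
(* The perturbation of the form is at most [e * s ^+ 2 <= e * (k ^+ 2 * q)], which this choice keeps
   strictly below [q]. *)
pose e := (k ^+ 2 + 1)^-1.
have k1 : 0 < k ^+ 2 + 1 by rewrite ltr_wpDl// sqr_ge0.
have e0 : 0 < e by rewrite invr_gt0.
exists e => // N Nsym NM; split=> // x x0.
pose y := L^T *m x.
have xE : x = K *m y by rewrite /K /y -mulmxA [L *m _]mulmxA -ML mulKmx.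
pose q : R := (x^T *m M *m x) 0 0.
have q0 : 0 < q by case: Mpd => _; apply.
have qE : q = \sum_i (y i 0) ^+ 2.
  rewrite /q ML mulmxA -mulmxA -/y -[L]trmxK -trmx_mul -/y mxE.
  by apply: eq_bigr => i _; rewrite mxE expr2.
have yq i : `|y i 0| <= Num.sqrt q.
  rewrite -sqrtr_sqr ler_sqrt ?(ltW q0)// qE (bigD1 i)//= lerDl.
  by apply: sumr_ge0 => j _; exact: sqr_ge0.
pose s := \sum_i `|x i 0|.
have sk : s <= k * Num.sqrt q.
  rewrite /k mulr_suml; apply: ler_sum => i _; rewrite {1}xE mxE mulr_suml.
  apply: le_trans (ler_norm_sum _ _ _) _; apply: ler_sum => j _.
  by rewrite normrM ler_wpM2l.
have s0 : 0 <= s by apply: sumr_ge0 => i _.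
have s2 : s ^+ 2 <= k ^+ 2 * q.
  rewrite -[in leRHS](sqr_sqrtr (ltW q0)) -exprMn.
  by rewrite ler_pXn2r// nnegrE// mulr_ge0// sqrtr_ge0.
have pert : `|(x^T *m (N - M) *m x) 0 0| <= e * s ^+ 2.
  rewrite mxE; apply: le_trans (ler_norm_sum _ _ _) _.
  rewrite expr2 [in leRHS]/s mulrA mulr_sumr; apply: ler_sum => j _.
  rewrite normrM ler_wpM2r// mxE; apply: le_trans (ler_norm_sum _ _ _) _.
  rewrite mulr_sumr; apply: ler_sum => i _.
  by rewrite normrM mulrC !mxE ler_wpM2r.
have eq_lt : e * s ^+ 2 < q.
  apply: (@le_lt_trans _ _ (e * (k ^+ 2 * q))).
    by rewrite ler_wpM2l// ltW.
  by rewrite /e mulrC ltr_pdivrMr// mulrDr mulr1 mulrC ltrDl.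
have -> : (x^T *m N *m x) 0 0 = q + (x^T *m (N - M) *m x) 0 0.
  by rewrite -{1}(subrK M N) mulmxDr mulmxDl mxE addrC.
have := le_lt_trans pert eq_lt; rewrite ltr_norml => /andP[lo _].
by rewrite -ltrBlDl sub0r.
Qed.

(** * The velocity field *)

(** Each Kronecker summand of [G] contributes a trace covered by [posdef_trace_gt0], with [X] and
    [C^-1] in exchanged roles. *)
Lemma Gmat_posdef {R : rcfType} {n : nat} (C X M : 'M[R]_n) :
  posdef C -> posdef X -> M != 0 ->
  0 < ((vec M)^T *m Gmat C X *m vec M) 0 0.
Proof.
move=> Cpd Xpd M0; have Cipd := posdef_invmx C Cpd.
case: (Cpd) (Xpd) => Csym _ [Xsym _].
rewrite -mulmxA Gmat_vec// dot_vec -scalemxAr mxtraceZ mulmxDr mxtraceD !mulmxA.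
rewrite Xsym mulr_gt0 ?invr_gt0 ?ltr0n// addr_gt0//.
  exact: posdef_trace_gt0.
exact: posdef_trace_gt0.
Qed.

Lemma normal_quad {R : comPzRingType} {m n : nat} (A : 'I_m -> 'M[R]_n)
    (G : 'M[R]_(n * n)) (w : 'cV[R]_m) :
  w^T *m (calA A *m G *m (calA A)^T) *m w =
  (vec (\sum_l w l 0 *: A l))^T *m G *m vec (\sum_l w l 0 *: A l).
Proof. by rewrite -trmx_calA_mul trmx_mul trmxK !mulmxA. Qed.

Lemma normal_quad_ge0 {R : rcfType} {m n : nat} (A : 'I_m -> 'M[R]_n)
    (C X : 'M[R]_n) (w : 'cV[R]_m) :
  posdef C -> posdef X ->
  0 <= (w^T *m (calA A *m Gmat C X *m (calA A)^T) *m w) 0 0.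
Proof.
move=> Cpd Xpd; rewrite normal_quad.
have [->|B0] := eqVneq (\sum_l w l 0 *: A l) 0; last exact/ltW/Gmat_posdef.
have -> : vec (0 : 'M[R]_n) = 0 by apply/matrixP => i j; rewrite !mxE.
by rewrite mulmx0 mxE.
Qed.

(** A kernel vector [w] annihilates the form of [G] at [\sum_l w_l A_l], so this combination is
    zero, and independence of the [A l] gives [w = 0]. *)
Lemma normal_unitmx {R : rcfType} {m n : nat} (A : 'I_m -> 'M[R]_n)
    (C X : 'M[R]_n) :
  posdef C -> posdef X -> row_free (calA A) ->
  calA A *m Gmat C X *m (calA A)^T \in unitmx.
Proof.
move=> Cpd Xpd Afree; apply: unitmx_ker0 => w Nw0.
have : (w^T *m (calA A *m Gmat C X *m (calA A)^T) *m w) 0 0 = 0.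
  by rewrite -mulmxA Nw0 mulmx0 mxE.
rewrite normal_quad; have [B0 _|B0 q0] := eqVneq (\sum_l w l 0 *: A l) 0.
  apply: trmx_inj; rewrite trmx0; apply: (row_free_inj Afree).
  rewrite mul0mx; apply: trmx_inj; rewrite trmx_mul trmxK trmx_calA_mul B0.
  by apply/matrixP => i j; rewrite !mxE.
by have := Gmat_posdef C X _ Cpd Xpd B0; rewrite q0 ltxx.
Qed.

Section Velocity.
Context {R : realType} {m n : nat}.
Variables (C : 'M[R]_n) (A : 'I_m -> 'M[R]_n) (b : 'cV[R]_m) (X Y : 'M[R]_n).
Hypotheses (Cpd : posdef C) (Asym : forall l, (A l)^T = A l).
Let G := Gmat C X.
Let N := calA A *m G *m (calA A)^T.
(** The multiplier of the projection: with it, [vec Y = G (vec B - vec C)]. *)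
Let w := invmx N *m calA A *m G *m vec C.
Let B := \sum_l w l 0 *: A l.
Hypothesis YE :
  vec Y = - ((1%:M - G *m (calA A)^T *m invmx N *m calA A) *m G *m vec C).

Lemma Gmat_vecC : G *m vec C = vec (2^-1 *: (X + X^T)).
Proof.
case: (Cpd) => Csym _; have Cu := posdef_unitmx C Cpd.
by rewrite Gmat_vec// mulmxK// mulVmx// mul1mx.
Qed.

Lemma velocityE :
  Y = 2^-1 *: (X *m B *m invmx C + invmx C *m B *m X^T) - 2^-1 *: (X + X^T).
Proof.
case: (Cpd) => Csym _; apply: vec_inj.
rewrite YE vecD vecN -Gmat_vecC -Gmat_vec// -trmx_calA_mul /w.
by rewrite !mulmxBl mul1mx !mulmxA opprB.
Qed.

(** As [B] and [C] are symmetric, transposition exchanges the two summands of each average. *)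
Lemma velocity_sym : Y^T = Y.
Proof.
case: (Cpd) => Csym _; rewrite velocityE.
have Bsym : B^T = B by exact: trmx_sum_sym.
have trZB (U V : 'M[R]_n) :
    (2^-1 *: U - 2^-1 *: V)^T = 2^-1 *: U^T - 2^-1 *: V^T.
  by apply/matrixP => i j; rewrite !mxE.
rewrite trZB; congr (_ *: _ - _ *: _); rewrite linearD /= ?trmxK 1?addrC//.
by rewrite !trmx_mul trmx_inv Csym Bsym trmxK !mulmxA.
Qed.

(** Applying [calA A] to the projection leaves [calA A - N N^-1 calA A], which vanishes once [N] is
    invertible. *)
Lemma calA_velocity : N \in unitmx -> calA A *m vec Y = 0.
Proof.
move=> Nu; rewrite YE mulmxN !mulmxA mulmxBr mulmx1 !mulmxA.
by rewrite -/N mulmxV// mul1mx subrr !mul0mx oppr0.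
Qed.

(** The two feasibility assumptions act separately: that of [X] gives [w = N^-1 b], because
    [G vec C = vec X], and that of [C^-1] turns [\tr (B C^-1)] into [w^T b]. *)
Lemma trace_velocity : posdef X -> linfeas A b (invmx C) -> linfeas A b X ->
  \tr (Y *m invmx X) = - n%:R + (b^T *m invmx N *m b) 0 0.
Proof.
move=> Xpd bC bX; have Xu := posdef_unitmx X Xpd; case: (Xpd) => Xsym _.
case: (Cpd) => Csym _.
have half : 2^-1 *: (X + X^T) = X.
  rewrite Xsym; apply/matrixP => i j; rewrite !mxE; lra.
have wE : w = invmx N *m b by rewrite /w -mulmxA Gmat_vecC half -mulmxA bX.
have trB : \tr (B *m invmx C) = (b^T *m invmx N *m b) 0 0.
  have -> : \tr (B *m invmx C) = (w^T *m b) 0 0.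
    rewrite -bC mulmxA -[calA A]trmxK -trmx_mul trmx_calA_mul dot_vec.
    by rewrite trmx_sum_sym.
  transitivity ((w^T *m b)^T 0 0); first by rewrite [RHS]mxE.
  by rewrite trmx_mul trmxK wE mulmxA.
rewrite velocityE half Xsym mulmxBl mulmxV// linearB /= mxtrace1 addrC.
congr (_ + _); rewrite -scalemxAl mxtraceZ mulmxDl mxtraceD mulmxK//.
rewrite [\tr (_ *m invmx X)]mxtrace_mulC !mulmxA mulVmx// mul1mx.
rewrite [\tr (invmx C *m B)]mxtrace_mulC trB; lra.
Qed.

End Velocity.

(** * Derivatives of matrix-valued functions *)

Lemma derivable_near {R : realType} {U : normedModType R} (f : R -> U)
    (t e : R) :
  derivable f t 1 -> 0 < e ->
  exists2 d : R, 0 < d & forall s, `|t - s| < d -> `|f t - f s| < e.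
Proof.
move=> /derivable1_diffP/differentiable_continuous/cvgrPdist_lt/[apply].
by move=> /nbhs_ballP[d d0 fd]; exists d => // s ts; exact: fd.
Qed.

(** This replaces integration throughout: a zero derivative gives conservation, a nonnegative one
    gives growth. *)
Lemma derivable_mean {R : realType} (f : R -> R) (T : R) : 0 < T ->
  (forall t, 0 <= t -> derivable f t 1) ->
  exists2 c, 0 < c < T & f T - f 0 = 'D_1 f c * T.
Proof.
move=> T0 fd.
have fD c : c \in `]0, T[ -> is_derive c 1 f ('D_1 f c).
  by rewrite in_itv /= => /andP[/ltW c0 _]; split=> //; exact: fd.
have [|c cT ->] := MVT T0 fD.
  apply: derivable_within_continuous => t; rewrite in_itv /= => /andP[t0 _].
  exact: fd.
by exists c; rewrite ?subr0// -in_itv.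
Qed.

(** Covers the constraint functionals ([P = (A l)^T]) and, by [quad_trace], the quadratic forms
    ([P = x x^T]). *)
Lemma is_derive_trace_mul {R : realType} {n : nat} (P : 'M[R]_n)
    (X : R -> 'M[R]_n) (t : R) : derivable X t 1 ->
  is_derive t 1 (fun s => \tr (P *m X s)) (\tr (P *m 'D_1 X t)).
Proof.
move=> Xd.
have -> : (fun s => \tr (P *m X s)) =
    \sum_i \sum_j (P i j *: (fun s : R => X s j i : R)).
  apply/funext => s; rewrite fct_sumE; apply: eq_bigr => i _.
  by rewrite fct_sumE mxE; apply: eq_bigr => j _.
have -> : \tr (P *m 'D_1 X t) =
    \sum_i \sum_j (P i j *: ('D_1 (fun s : R => X s j i : R) t)).
  apply: eq_bigr => i _; rewrite mxE; apply: eq_bigr => j _.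
  by rewrite derive_mx// mxE.
apply: is_derive_sum => i; apply: is_derive_sum => j; apply: is_deriveZ.
by split=> //; exact: (derivable_mxP X t 1).1.
Qed.

Lemma is_derive_prod {R : realType} {n : nat} (f : 'I_n -> R -> R)
    (df : 'I_n -> R) (t : R) :
  (forall i, is_derive t 1 (f i) (df i)) ->
  is_derive t 1 (fun s => \prod_i f i s)
    (\sum_i \prod_j (if j == i then df j else f j t)).
Proof.
elim: n f df => [|n IHn] f df fd.
  rewrite big_ord0.
  have -> : (fun s => \prod_(i < 0) f i s) = cst 1.
    by apply/funext => s; rewrite big_ord0.
  exact: is_derive_cst.
have -> : (fun s => \prod_i f i s) =
    (fun s => \prod_i f (widen_ord (leqnSn n) i) s) * f ord_max.
  by apply/funext => s; rewrite big_ord_recr.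
have IH := IHn _ _ (fun i => fd (widen_ord (leqnSn n) i)).
apply: (is_derive_eq (is_deriveM IH (fd ord_max))).
rewrite [LHS]addrC [RHS]big_ord_recr /=; congr (_ + _).
  rewrite [LHS]mulr_sumr; apply: eq_bigr => i _.
  rewrite [RHS]big_ord_recr /= mulrC; congr (_ * _).
    by rewrite -val_eqE /= eq_sym ltn_eqF.
rewrite [RHS]big_ord_recr /= eqxx; congr (_ * _).
by apply: eq_bigr => i _; rewrite -val_eqE /= ltn_eqF.
Qed.

(** The Leibniz expansion is differentiated termwise; the result is the sum of the determinants
    [\det (Z i)], where row [i] is replaced by its derivative, and expanding along that row produces
    cofactors. The adjugate form also covers singular matrices, as required at a time whose
    positivity is still open. *)
Lemma is_derive_det {R : realType} {n : nat} (X : R -> 'M[R]_n) (t : R) :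
  derivable X t 1 ->
  is_derive t 1 (fun s => \det (X s)) (\tr ('D_1 X t *m \adj (X t))).
Proof.
move=> Xd; set Y := 'D_1 X t.
have Xij i j : is_derive t 1 (fun s => X s i j : R) (Y i j).
  have := (derivable_mxP X t 1).1 Xd i j => Xdij.
  by split=> //; rewrite /Y derive_mx// mxE.
pose Z i := \matrix_(k, l) (if k == i then Y k l else X t k l).
have -> : \tr (Y *m \adj (X t)) = \sum_i \det (Z i).
  apply: eq_bigr => i _; rewrite mxE (expand_det_row _ i).
  apply: eq_bigr => j _.
  rewrite !mxE eqxx; congr (_ * (_ * \det _)).
  by apply/matrixP => k l; rewrite !mxE eq_sym (negbTE (neq_lift _ _)).
rewrite /determinant exchange_big /=.
have -> : (fun s => \det (X s)) =
    \sum_(g : 'S_n) ((-1) ^+ g *: (fun s => \prod_i X s i (g i))).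
  by apply/funext => s; rewrite fct_sumE.
apply: (big_ind2 (fun F dF => is_derive t 1 F dF)) => [|F dF K dK Fd Kd|g _].
- exact: is_derive_cst.
- exact: is_deriveD.
rewrite -mulr_sumr.
under eq_bigr do under eq_bigr do rewrite mxE.
apply: is_deriveZ.
exact: (is_derive_prod (fun i s => X s i (g i)) (fun i => Y i (g i))).
Qed.

Lemma is_derive_ln_det {R : realType} {n : nat} (X : R -> 'M[R]_n) (t : R) :
  derivable X t 1 -> 0 < \det (X t) ->
  is_derive t 1 (fun s => ln (\det (X s))) (\tr ('D_1 X t *m invmx (X t))).
Proof.
move=> Xd det0; have Xdet := is_derive_det X t Xd.
have := is_derive1_comp (is_derive1_ln det0) Xdet.
by rewrite /invmx unitmxE unitfE gt_eqF//= -scalemxAr mxtraceZ.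
Qed.

Lemma le_norm_coord {R : realType} {m n : nat} (M : 'M[R]_(m, n)) i j :
  `|M i j| <= `|M|.
Proof.
rewrite [leRHS]/Num.Def.normr/= mx_normrE.
exact: (le_bigmax _ (fun ij : 'I_m * 'I_n => `|M ij.1 ij.2|) (i, j)).
Qed.

Lemma is_derive_expRM {R : realType} (a t : R) :
  is_derive t 1 (fun s => expR (a * s)) (expR (a * t) * a).
Proof.
have := is_deriveZ a (is_derive_id t (1 : R)) => /= dZ.
have := is_derive1_comp (is_derive_expR (a * t)) dZ.
by rewrite [a *: _]mulr1.
Qed.

(** * The flow *)

Theorem theorem4p2 (R : realType) (n m : nat)
  (C : 'M[R]_n) (A : 'I_m -> 'M[R]_n) (b : 'cV[R]_m) (X : R -> 'M[R]_n) :
  C^T = C ->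
  (forall l, (A l)^T = A l) ->
  posdef C ->
  row_free (calA A) ->
  linfeas A b (invmx C) ->
  posdef (X 0) ->
  linfeas A b (X 0) ->
  (forall t, 0 <= t -> derivable X t 1) ->
  (forall t, 0 <= t ->
     let G := Gmat C (X t) in
     vec ('D_1 X t) =
       - ((1%:M - G *m (calA A)^T *m invmx (calA A *m G *m (calA A)^T)
                    *m calA A) *m G *m vec C)) ->
  (forall t, 0 <= t -> posdef (X t) ->
     let G := Gmat C (X t) in
     let r := (b^T *m invmx (calA A *m G *m (calA A)^T) *m b) 0 0 in
     derivable (fun s => ln (\det (X s))) t 1 /\
     'D_1 (fun s => ln (\det (X s))) t = - n%:R + r /\
     - n%:R + r >= - n%:R)
  /\ (forall T, 0 <= T -> posdef (X T)).
Proof.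
move=> Csym Asym Cpd Afree bC X0pd X0feas Xd ode.
have Xsym t : 0 <= t -> (X t)^T = X t.
  rewrite le_eqVlt => /predU1P[<-|t0]; first by case: X0pd.
  apply/matrixP => i j; rewrite mxE.
  (* Each antisymmetric entry has zero derivative, hence keeps its initial value [0]. *)
  pose f : R -> R := (fun s => X s j i : R) - (fun s => X s i j : R).
  have fD (s : R) : 0 <= s -> is_derive s 1 f 0.
    move=> s0; have Xij k l : derivable (fun s : R => X s k l : R) s 1.
      exact: (derivable_mxP X s 1).1 (Xd s s0) k l.
    have fB := is_deriveB (derivableP (Xij j i)) (derivableP (Xij i j)).
    apply: (is_derive_eq fB).
    have /matrixP/(_ i j) :=
      velocity_sym C A (X s) ('D_1 X s) Cpd Asym (ode s s0).
    by rewrite derive_mx ?mxE; [move=> ->; rewrite subrr | exact: Xd].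
  have [|c /andP[/ltW c0 _]] := derivable_mean f t t0.
    by move=> s /fD[].
  have [_ ->] := fD c c0; rewrite mul0r => /subr0_eq ft.
  have /matrixP/(_ i j) : (X 0)^T = X 0 by case: X0pd.
  rewrite mxE => X0; apply/subr0_eq.
  by rewrite -[LHS]/(f t) ft /f !fctE X0 subrr.
(* Positivity is asked only strictly inside the interval, since the mean value theorem evaluates the
   derivative there. *)
have feas T : 0 <= T -> (forall s, 0 < s < T -> posdef (X s)) ->
    linfeas A b (X T).
  rewrite le_eqVlt => /predU1P[<-//|T0] Xpd.
  rewrite /linfeas -X0feas; apply/matrixP => l z; rewrite ord1 !calA_vecE.
  pose f s := \tr ((A l)^T *m X s).
  have [|c cT] := derivable_mean f T T0.
    by move=> s /Xd/(is_derive_trace_mul (A l)^T)[].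
  have c0 : 0 <= c by case/andP: cT => /ltW.
  have [_ ->] := is_derive_trace_mul (A l)^T X c (Xd c c0).
  have Nu := normal_unitmx A C (X c) Cpd (Xpd c cT) Afree.
  have -> : \tr ((A l)^T *m 'D_1 X c) = 0.
    by rewrite -calA_vecE (calA_velocity C A (X c) _ (ode c c0) Nu) mxE.
  by rewrite mul0r => /subr0_eq.
pose r t :=
  (b^T *m invmx (calA A *m Gmat C (X t) *m (calA A)^T) *m b) 0 0.
have r_ge0 t : posdef (X t) -> 0 <= r t.
  move=> Xpd; apply: quad_invmx_ge0; first exact: normal_unitmx.
  by move=> u; exact: normal_quad_ge0.
have trX t : 0 <= t -> (forall s, 0 < s <= t -> posdef (X s)) -> posdef (X t) ->
    \tr ('D_1 X t *m invmx (X t)) = - n%:R + r t.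
  move=> t0 Xpd Xtpd.
  apply: (trace_velocity C A b (X t) ('D_1 X t) Cpd Asym (ode t t0) Xtpd bC).
  by apply: feas => // s /andP[s0 /ltW st]; apply: Xpd; rewrite s0.
have Xpd T : 0 <= T -> posdef (X T).
  move=> T0; apply: contrapT => nXT.
  pose E := [set s | 0 <= s /\ ~ posdef (X s)]%classic.
  have E0 : lbound E 0 by move=> s [].
  have Einf : has_inf E by split; [exists T | exists 0].
  pose S := inf E.
  have S0 : 0 <= S by apply: lb_le_inf => //; exists T.
  have below s : 0 <= s -> s < S -> posdef (X s).
    move=> s0 sS; apply: contrapT => nXs.
    have : S <= s by apply: ge_inf => //; exists 0.
    by rewrite leNgt sS.
  have XS : posdef (X S).
    move: S0; rewrite le_eqVlt => /predU1P[<-//|S0].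
    have XSsym : (X S)^T = X S by apply: Xsym; exact: ltW.
    apply: psd_unit_posdef => //.
      (* A negative value at [S] would persist at nearby earlier times, where [X] is positive
         definite. *)
      move=> x; rewrite leNgt; apply/negP => neg.
      pose f s := \tr (x *m x^T *m X s).
      have fS : f S < 0 by rewrite /f -quad_trace.
      have fd : derivable f S 1.
        by have [] := is_derive_trace_mul (x *m x^T) X S (Xd S (ltW S0)).
      have [|d d0 near_S] := derivable_near f S (- f S) fd.
        by rewrite oppr_gt0.
      (* Within [d] to the left of [S], and truncated at [0] so as to stay in the domain of the
         flow. *)
      pose s := Num.max 0 (S - d / 2).
      have s0 : 0 <= s by rewrite le_max lexx.
      have sS : s < S by rewrite gt_max S0 gtrBl divr_gt0.
      have Ss : S - d / 2 <= s by rewrite le_max lexx orbT.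
      have : `|f S - f s| < - f S.
        by apply: near_S; rewrite gtr0_norm ?subr_gt0//; lra.
      have : 0 <= f s by rewrite /f -quad_trace; exact/posdef_ge0/below.
      by rewrite ltr_norml => fs /andP[+ _]; lra.
    rewrite unitmxE unitfE gt_eqF//.
    (* The integrating factor cancels the [- n] in [(det X)' = det X * (- n + r)], leaving
       [h' = h * r >= 0] before [S]. The logarithm is avoided because [\det (X S) > 0] is what is
       being proved. *)
    pose h : R -> R := (fun s => \det (X s)) * (fun s => expR (n%:R * s)).
    have hD s (s0 : 0 <= s) :=
      is_deriveM (is_derive_det X s (Xd s s0)) (is_derive_expRM n%:R s).
    have [|c /andP[c0 cS]] := derivable_mean h S S0.
      by move=> s s0; case: (hD s s0).
    have [_ ->] := hD c (ltW c0).
    have Xc : posdef (X c) by apply: below => //; exact: ltW.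
    have det0 := posdef_det_gt0 _ Xc.
    have adjE : \tr ('D_1 X c *m \adj (X c)) = \det (X c) * (- n%:R + r c).
      rewrite -trX ?(ltW c0)//; last first.
        move=> s /andP[/ltW s0 sc]; apply: below => //.
        exact: le_lt_trans cS.
      rewrite /invmx posdef_unitmx// -scalemxAr mxtraceZ mulrA divff ?mul1r//.
      by rewrite gt_eqF.
    rewrite adjE => hS.
    have : h 0 <= h S.
      rewrite -subr_ge0 hS mulr_ge0// ?(ltW S0)//.
      have -> : \det (X c) *: (expR (n%:R * c) * n%:R) +
         expR (n%:R * c) *: (\det (X c) * (- n%:R + r c)) =
         \det (X c) * expR (n%:R * c) * r c by rewrite /GRing.scale /=; ring.
      by rewrite !mulr_ge0 ?expR_ge0 ?(ltW det0)// r_ge0.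
    rewrite /h !fctE mulr0 expR0 mulr1 => hle.
    have : 0 < \det (X S) * expR (n%:R * S).
      by apply: lt_le_trans hle; exact: posdef_det_gt0.
    by rewrite pmulr_lgt0// expR_gt0.
  have [e e0 Xe] := posdef_near _ XS.
  have [d d0 Xnear] := derivable_near X S e (Xd S S0) e0.
  (* Bad times occur in [[S, S + d[], where [X] is within [e] of [X S] and so still positive
     definite. *)
  have [s [s0 nXs] sd] := inf_adherent d0 Einf.
  have Ss : S <= s by apply: ge_inf; [exists 0 | split].
  apply: nXs; apply: Xe; first exact: Xsym.
  have /Xnear/ltW Xse : `|S - s| < d.
    by rewrite distrC ger0_norm ?subr_ge0// ltrBlDl.
  move=> i j; apply: le_trans Xse; rewrite distrC.
  by have := le_norm_coord (X S - X s) i j; rewrite !mxE.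
split=> // t t0 Xt G0 r0.
have [dln Dln] := is_derive_ln_det X t (Xd t t0) (posdef_det_gt0 _ Xt).
split=> //; split; last by rewrite lerDl; exact: r_ge0.
rewrite Dln; apply: trX => // s /andP[s0 _]; apply: Xpd; exact: ltW.
Qed.
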